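(* Let $\mathcal D_1$ and $\mathcal D_2$ be two commutative, totally ordered, idempotent dioids and $\mathcal A$ a commutative semiring. Then, identifying $(D_1\times D_2)\times A$ with $D_1\times(D_2\times A)$ via $((d_1,d_2),a)\leftrightarrow(d_1,(d_2,a))$, we have $(\mathcal D_1\Delta\mathcal D_2)\Delta\mathcal A=\mathcal D_1\Delta(\mathcal D_2\Delta\mathcal A)$ (same underlying set, same addition, same multiplication, same zero and unit).
   Context: A semiring $(A,+,\times,0,1)$: $(A,+,0)$ commutative monoid, $(A,\times,1)$ monoid, $\times$ distributes over $+$, $0$ absorbing for $\times$, $0\ne1$; commutative if $\times$ is. A dioid is a semiring $(D,\min,+_D,\infty_D,0_D)$ ($\min$ names the additive operation, $+_D$ the multiplicative one) for which $d_1\le_D d_2\iff\exists c,\ \min(d_2,c)=d_1$ is a partial order; idempotent if $\min(d,d)=d$; totally ordered if $\le_D$ is total. An element $d\in D\setminus\{\infty_D\}$ is multiplicatively regular if $d+_Db=d+_Dc\Rightarrow b=c$; $reg(\mathcal D)$ is the set of these. For a commutative totally ordered idempotent dioid $\mathcal D$ and a commutative semiring $\mathcal A=(A,+_A,\times_A,0_A,1_A)$, the delta product is $\mathcal D\Delta\mathcal A=(D\Delta A,\oplus,\otimes,(\infty_D,0_A),(0_D,1_A))$ with $D\Delta A=\{(d,a): d\in reg(\mathcal D)\text{ or }a=0_A\}$, $(d_1,a_1)\oplus(d_2,a_2)=(\min(d_1,d_2),a)$ where $a=a_1$ if $d_1<_Dd_2$, $a=a_2$ if $d_2<_Dd_1$,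 $a=a_1+_Aa_2$ if $d_1=d_2$; and $(d_1,a_1)\otimes(d_2,a_2)=(d_1+_Dd_2,a_1\times_Aa_2)$. In $\mathcal D_1\Delta\mathcal D_2$, $\mathcal D_2$ is regarded as a semiring (addition $\min_2$, multiplication $+_2$); it is known that $\mathcal D_1\Delta\mathcal D_2$ is again a commutative totally ordered idempotent dioid, so $(\mathcal D_1\Delta\mathcal D_2)\Delta\mathcal A$ is defined. *)

(* Defs.v *)
From HB Require Import structures.
From mathcomp Require Import all_boot all_algebra.
From mathcomp Require Import boolp classical_sets.

Set Implicit Arguments.
Unset Strict Implicit.
Unset Printing Implicit Defensive.

Import GRing.Theory.
Local Open Scope ring_scope.

(* A dioid (D, min, +_D, oo_D, 0_D) is a semiring with 0 <> 1, so in ring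
   notation: min is +, +_D is *, oo_D is 0 and 0_D is 1. *)

Definition dioid_le (D : nzSemiRingType) (d1 d2 : D) : Prop :=
  exists c, d2 + c = d1.

Definition dioid_lt (D : nzSemiRingType) (d1 d2 : D) : Prop :=
  dioid_le d1 d2 /\ d1 <> d2.

Definition is_partial_order (T : Type) (le : T -> T -> Prop) : Prop :=
  [/\ forall x, le x x,
      forall x y, le x y -> le y x -> x = y
    & forall x y z, le x y -> le y z -> le x z].

HB.mixin Record NzSemiRing_isDioid D of GRing.NzSemiRing D := {
  dioid_le_po : is_partial_order (@dioid_le D)
}.

#[short(type="dioidType")]
HB.structure Definition Dioid :=
  { D of GRing.NzSemiRing D & NzSemiRing_isDioid D }.

HB.mixin Record Dioid_isTotalIdempotent D of Dioid D := {
  dioid_addxx : forall d : D, d + d = d;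
  dioid_le_total : forall d1 d2 : D, dioid_le d1 d2 \/ dioid_le d2 d1
}.

(* Cti: commutative, totally ordered, idempotent *)
#[short(type="ctiDioidType")]
HB.structure Definition CtiDioid :=
  { D of GRing.ComNzSemiRing D & Dioid D & Dioid_isTotalIdempotent D }.

Definition mregular (D : nzSemiRingType) (d : D) : Prop :=
  d <> 0 /\ forall b c, d * b = d * c -> b = c.

Section DeltaProduct.
Variables (D : ctiDioidType) (A : comNzSemiRingType).
Implicit Types (d : D) (a : A).

Definition delta_mem (x : D * A) : bool := `[< mregular x.1 \/ x.2 = 0 >].

(* a record, so that it does not inherit the componentwise operations of the
   product type D * A *)
Record delta := Delta { delta_val : D * A; deltaP : delta_mem delta_val }.

HB.instance Definition _ := [isSub for delta_val].
HB.instance Definition _ := [Choice of delta by <:].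

(* the order being total, the last branch is the case x.1 = y.1 *)
Definition delta_add_val (x y : D * A) : D * A :=
  (x.1 + y.1,
   if `[< dioid_lt x.1 y.1 >] then x.2
   else if `[< dioid_lt y.1 x.1 >] then y.2
   else x.2 + y.2).

Definition delta_mul_val (x y : D * A) : D * A := (x.1 * y.1, x.2 * y.2).

Lemma dioid_leE d1 d2 : dioid_le d1 d2 <-> d1 + d2 = d1.
Proof.
split=> [[c <-]|h]; last by exists d1; rewrite addrC.
by rewrite addrAC dioid_addxx.
Qed.

Lemma mregular1 : mregular (1 : D).
Proof. by split=> [|b c]; [apply/eqP; exact: oner_neq0|rewrite !mul1r]. Qed.

Lemma mregularM d1 d2 : mregular d1 -> mregular d2 -> mregular (d1 * d2).
Proof.
move=> [_ r1] [n2 r2]; split=> [h|b c]; last by rewrite -!mulrA => /r1/r2.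
by apply: n2; apply: r1; rewrite h mulr0.
Qed.

Definition keep (b : bool) a : A := if b then a else 0.

Lemma delta_add_valE x y : delta_add_val x y =
  (x.1 + y.1, keep (x.1 + y.1 == x.1) x.2 + keep (x.1 + y.1 == y.1) y.2).
Proof.
rewrite /delta_add_val /keep; congr (_, _).
case: asboolP => [[/dioid_leE -> /eqP n]|h1].
  by rewrite eqxx (negPf n) addr0.
case: asboolP => [[/dioid_leE]|h2].
  by rewrite addrC => -> /eqP n; rewrite eqxx (negPf n) add0r.
have -> : x.1 = y.1.
  by apply: contrapT => n; case: (dioid_le_total x.1 y.1) => h;
    [apply: h1|apply: h2; split=> // /esym].
by rewrite dioid_addxx eqxx.
Qed.

Lemma delta_add_mem x y : delta_mem x -> delta_mem y ->
  delta_mem (delta_add_val x y).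
Proof.
move=> /asboolP hx /asboolP hy; apply/asboolP.
rewrite delta_add_valE /= /keep.
case: (eqVneq (x.1 + y.1) x.1) => [ex|nx];
  case: (eqVneq (x.1 + y.1) y.1) => [ey|ny].
- have e : x.1 = y.1 by rewrite -ex ey.
  rewrite ex; case: hx => [|->]; first by left.
  by case: hy => [|->]; [rewrite -e; left|rewrite addr0; right].
- by rewrite ex addr0.
- by rewrite ey add0r.
- by rewrite addr0; right.
Qed.

Lemma delta_mul_mem x y : delta_mem x -> delta_mem y ->
  delta_mem (delta_mul_val x y).
Proof.
move=> /asboolP [rx|x0] /asboolP [ry|y0]; apply/asboolP => /=.
- by left; apply: mregularM.
- by right; rewrite y0 mulr0.
- by right; rewrite x0 mul0r.
- by right; rewrite x0 mul0r.
Qed.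

Lemma delta_zero_mem : delta_mem (0, 0).
Proof. by apply/asboolP; right. Qed.

Lemma delta_one_mem : delta_mem (1, 1).
Proof. by apply/asboolP; left; apply: mregular1. Qed.

Definition delta_zero : delta := Delta delta_zero_mem.
Definition delta_one : delta := Delta delta_one_mem.
Definition delta_add (x y : delta) : delta :=
  Delta (delta_add_mem (deltaP x) (deltaP y)).
Definition delta_mul (x y : delta) : delta :=
  Delta (delta_mul_mem (deltaP x) (deltaP y)).

Lemma keepD b a1 a2 : keep b (a1 + a2) = keep b a1 + keep b a2.
Proof. by case: b; rewrite /= ?addr0. Qed.

Lemma keep_keep b c a : keep b (keep c a) = keep (b && c) a.
Proof. by case: b; case: c. Qed.

Lemma eqD_l (x y z : D) : (x + y + z == x + y) && (x + y == x) = (x + y + z == x).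
Proof.
apply/andP/eqP => [[/eqP -> /eqP]//|h].
have e : x + y = x by rewrite -{1}h addrAC -(addrA x) dioid_addxx.
by rewrite h e eqxx.
Qed.

Lemma delta_addC : commutative delta_add.
Proof.
move=> x y; apply: val_inj => /=; rewrite !delta_add_valE.
by congr (_, _); rewrite 1?[LHS]addrC // (addrC (val y).1).
Qed.

Lemma delta_addA : associative delta_add.
Proof.
move=> [[x a] px] [[y b] py] [[z c] pz]; apply: val_inj => /=.
rewrite !delta_add_valE /=; congr (_, _); first by rewrite addrA.
rewrite !keepD !keep_keep eqD_l (addrA x y z) [LHS]addrA.
congr (keep _ a + keep _ b + keep _ c).
- have -> : x + y + z = y + z + x by rewrite -addrA addrC.
  by rewrite eqD_l (addrC x y) addrAC eqD_l.
- have -> : x + y + z = z + y + x by rewrite -addrA addrC (addrC y).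
  by rewrite (addrC y z) eqD_l.
Qed.

Lemma delta_add0 : left_id delta_zero delta_add.
Proof.
move=> [[x a] px]; apply: val_inj => /=; rewrite delta_add_valE /= add0r eqxx.
by congr (_, _); rewrite /keep if_same add0r.
Qed.

HB.instance Definition _ :=
  GRing.isNmodule.Build delta delta_addA delta_addC delta_add0.

Lemma delta_mulA : associative delta_mul.
Proof.
by move=> x y z; apply: val_inj; rewrite /= /delta_mul_val /= !mulrA.
Qed.

Lemma delta_mulC : commutative delta_mul.
Proof.
move=> x y; apply: val_inj; rewrite /= /delta_mul_val.
by rewrite (mulrC (val x).1) (mulrC (val x).2).
Qed.

Lemma delta_mul1 : left_id delta_one delta_mul.
Proof.
by move=> [[x a] px]; apply: val_inj; rewrite /= /delta_mul_val /= !mul1r.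
Qed.

Lemma delta_mul0 : left_zero (0 : delta) delta_mul.
Proof.
by move=> [[x a] px]; apply: val_inj; rewrite /= /delta_mul_val /= !mul0r.
Qed.

Lemma delta_mulDl : left_distributive delta_mul +%R.
Proof.
move=> [[x a] px] [[y b] py] [[z c] pz]; apply: val_inj => /=.
rewrite /delta_mul_val !delta_add_valE /=; congr (_, _); first exact: mulrDl.
case/asboolP: pz => /= [[_ rz]|->].
  have inj u v : (u * z == v * z) = (u == v).
    apply/eqP/eqP => [|->//].
    by rewrite !(mulrC _ z) => /rz.
  rewrite -mulrDl !inj [LHS]mulrDl.
  by congr (_ + _); rewrite /keep; case: ifP; rewrite ?mul0r.
by rewrite !mulr0 /keep !if_same addr0.
Qed.

Lemma delta_one_neq0 : delta_one != 0.
Proof.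
apply/eqP => /(congr1 (fun u => (delta_val u).1)) /= /eqP.
by rewrite (negPf (oner_neq0 _)).
Qed.

HB.instance Definition _ := GRing.Nmodule_isComNzSemiRing.Build delta
  delta_mulA delta_mulC delta_mul1 delta_mulDl delta_mul0 delta_one_neq0.

End DeltaProduct.

Section DeltaDioid.
Variables (D1 D2 : ctiDioidType).
Local Notation D12 := (delta D1 D2).

Lemma delta_addxx (x : D12) : x + x = x.
Proof.
case: x => [[x a] px]; apply: val_inj => /=.
by rewrite delta_add_valE /keep /= dioid_addxx eqxx dioid_addxx.
Qed.

Lemma delta_le_po : is_partial_order (@dioid_le D12).
Proof.
have leE (x y : D12) : dioid_le x y -> x + y = x.
  by case=> c <-; rewrite addrAC delta_addxx.
split=> [x|x y /leE h1 /leE h2|x y z [c <-] [d <-]].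
- by exists 0; rewrite addr0.
- by rewrite -h1 addrC h2.
- by exists (d + c); rewrite addrA.
Qed.

Lemma delta_le_total (x y : D12) : dioid_le x y \/ dioid_le y x.
Proof.
suff: x + y = x \/ x + y = y.
  by case=> h; [left; exists x; rewrite addrC|right; exists y].
case: x y => [[x a] px] [[y b] py].
case: (dioid_le_total x y) => /dioid_leE h.
  case: (eqVneq x y) => [e|n].
    case: (dioid_le_total a b) => /dioid_leE k; [left|right]; apply: val_inj;
      rewrite /= delta_add_valE /keep /= -e dioid_addxx eqxx /= ?k //.
    by rewrite addrC k.
  left; apply: val_inj.
  by rewrite /= delta_add_valE /keep /= h eqxx (negPf n) /= addr0.
case: (eqVneq x y) => [e|n].
  case: (dioid_le_total a b) => /dioid_leE k; [left|right]; apply: val_inj;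
    rewrite /= delta_add_valE /keep /= -e dioid_addxx eqxx /= ?k //.
  by rewrite addrC k.
right; apply: val_inj.
by rewrite /= delta_add_valE /keep /= addrC h eqxx eq_sym (negPf n) /= add0r.
Qed.

HB.instance Definition _ := NzSemiRing_isDioid.Build D12 delta_le_po.
HB.instance Definition _ :=
  Dioid_isTotalIdempotent.Build D12 delta_addxx delta_le_total.

End DeltaDioid.

Section Reassociation.
Variables (D1 D2 : ctiDioidType) (A : comNzSemiRingType).

Definition reassoc (t : (D1 * D2) * A) : D1 * (D2 * A) :=
  (t.1.1, (t.1.2, t.2)).

(* the inclusions of the two iterated delta products into the full products;
   both are injective, delta being a subtype *)
Definition delta_incl_l (x : delta (delta D1 D2) A) : (D1 * D2) * A :=
  (delta_val (delta_val x).1, (delta_val x).2).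

Definition delta_incl_r (y : delta D1 (delta D2 A)) : D1 * (D2 * A) :=
  ((delta_val y).1, delta_val (delta_val y).2).

End Reassociation.

(* Main.v *)
(* Membership in (D1 Delta D2) Delta A involves the regular elements of
   D1 Delta D2, and its addition involves the order of D1 Delta D2. A pair is
   regular exactly when both of its components are: multiplying it by the
   elements (0_D, b) shows that the second component is regular, hence different
   from oo_D, and membership then makes the first component regular. The order
   is lexicographic. So both iterated products consist of the same triples,
   added by the same lexicographic rule. *)
Require Import Defs.
From HB Require Import structures.
From mathcomp Require Import all_boot all_algebra.
From mathcomp Require Import boolp classical_sets.

Set Implicit Arguments.
Unset Strict Implicit.
Unset Printing Implicit Defensive.

Import GRing.Theory.
Local Open Scope ring_scope.
Local Open Scope classical_set_scope.

Local Notation "d <D d'" := `[< dioid_lt d d' >] (at level 70).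

Lemma mregular_lreg (D : nzSemiRingType) (d : D) : mregular d <-> GRing.lreg d.
Proof.
split=> [[_ reg_d] //|reg_d].
by split; [exact/eqP/lreg_neq0|exact: reg_d].
Qed.

Section DioidOrder.
Variable D : ctiDioidType.
Implicit Types d : D.

Lemma dioid_ltE d d' : (d <D d') = (d + d' == d) && (d != d').
Proof.
apply/asboolP/andP => [[/dioid_leE/eqP le_dd' /eqP //]|].
by case=> /eqP/dioid_leE le_dd' /eqP.
Qed.

Variant dioid_compare d d' : bool -> bool -> bool -> Type :=
  | DioidLt of dioid_lt d d' : dioid_compare d d' true false false
  | DioidGt of dioid_lt d' d : dioid_compare d d' false true false
  | DioidEq of d = d' : dioid_compare d d' false false true.

Lemma dioid_ltgtP d d' : dioid_compare d d' (d <D d') (d' <D d) (d == d').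
Proof.
have [->|neq_dd'] := eqVneq d d'.
  by rewrite dioid_ltE eqxx andbF; constructor.
have [lt_dd'|nlt_dd'] := asboolP (dioid_lt d d').
  suff -> : (d' <D d) = false by constructor.
  case: lt_dd' => /dioid_leE min_dd' _.
  by rewrite dioid_ltE addrC min_dd' (negPf neq_dd').
suff lt_d'd : dioid_lt d' d by rewrite (asboolT lt_d'd); constructor.
have [le_dd'|le_d'd] := dioid_le_total d d'.
- by case: nlt_dd'; split=> //; exact/eqP.
- by split=> //; apply/nesym/eqP.
Qed.

End DioidOrder.

Section DeltaProduct.
Variables (D : ctiDioidType) (A : comNzSemiRingType).
Implicit Types x y : delta D A.

Lemma delta_mem_mregular (d : D) (a : A) : mregular d -> delta_mem (d, a).
Proof. by move=> reg_d; apply/asboolP; left. Qed.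

Lemma mregular_delta x :
  mregular x <-> mregular (delta_val x).1 /\ mregular (delta_val x).2.
Proof.
rewrite !mregular_lreg; split=> [reg_x|[reg_d reg_a] y z xy_xz].
- have reg_a : GRing.lreg (delta_val x).2.
    move=> b c ab_ac.
    pose unit_pair a := Delta (delta_mem_mregular a (mregular1 D)).
    suff /reg_x [] : x * unit_pair b = x * unit_pair c by [].
    by apply: val_inj; rewrite /= /delta_mul_val ab_ac.
  split=> //; case/asboolP: (deltaP x) => [/mregular_lreg //|a0].
  by have := lreg_neq0 reg_a; rewrite a0 eqxx.
- have [/reg_d eq_d /reg_a eq_a] := congr1 (@delta_val D A) xy_xz.
  by apply: val_inj; exact: injective_projections.
Qed.

End DeltaProduct.

Lemma delta_ltE (D1 D2 : ctiDioidType) (x y : delta D1 D2) :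
  (x <D y) = ((delta_val x).1 <D (delta_val y).1) ||
             ((delta_val x).1 == (delta_val y).1) &&
             ((delta_val x).2 <D (delta_val y).2).
Proof.
case: x y => [[d1 d2] mem_d] [[e1 e2] mem_e] /=.
rewrite !dioid_ltE -!val_eqE /= delta_add_valE /= !xpair_eqE /keep.
have [->|neq_de] := eqVneq d1 e1; first by rewrite dioid_addxx eqxx.
by case: eqP => //= ->; rewrite (negPf neq_de) addr0 eqxx.
Qed.

Section IteratedDeltaProduct.
Variables (D1 D2 : ctiDioidType) (A : comNzSemiRingType).
Local Notation L := (delta (delta D1 D2) A).
Local Notation R := (delta D1 (delta D2 A)).
Implicit Types t u : D1 * (D2 * A).

Definition delta_triple : set (D1 * (D2 * A)) :=
  [set t | [\/ mregular t.1 /\ mregular t.2.1, mregular t.1 /\ t.2.2 = 0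
             | t.2 = (0, 0)]].

Definition lex_add t u : D1 * (D2 * A) :=
  (t.1 + u.1,
   if t.1 <D u.1 then t.2
   else if u.1 <D t.1 then u.2
   else delta_add_val t.2 u.2).

Lemma range_reassoc_delta_incl_l :
  range (fun x : L => reassoc (delta_incl_l x)) = delta_triple.
Proof.
apply/seteqP; split=> [_ [[[[[d1 d2] mem_d] a] mem_x] _ <-]|[d1 [d2 a]] t_mem].
- rewrite /delta_triple /=; case/asboolP: (mem_x) => [/mregular_delta|/= ->].
    by constructor 1.
  by case/asboolP: (mem_d) => [reg_d1|/= ->]; [constructor 2|constructor 3].
- have mem_d : delta_mem (d1, d2).
    by apply/asboolP; case: t_mem => /= [[]|[]|[]]; auto.
  have mem_x : delta_mem (Delta mem_d, a).
    case: t_mem => /= [reg_d|[_ a0]|[_ a0]]; [|by apply/asboolP; right..].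
    by apply/delta_mem_mregular/mregular_delta.
  by exists (Delta mem_x).
Qed.

Lemma range_delta_incl_r : range (@delta_incl_r D1 D2 A) = delta_triple.
Proof.
apply/seteqP; split=> [_ [[[d1 [[d2 a] mem_da]] mem_y] _ <-]|[d1 [d2 a]] t_mem].
- rewrite /delta_triple /=; case/asboolP: (mem_y) => /= [reg_d1|[d20 a0]].
    by case/asboolP: (mem_da); [constructor 1|constructor 2].
  by constructor 3; rewrite d20 a0.
- have mem_da : delta_mem (d2, a).
    by apply/asboolP; case: t_mem => /= [[]|[]|[]]; auto.
  have mem_y : delta_mem (d1, Delta mem_da).
    apply/asboolP; case: t_mem => /= [[reg_d1 _]|[reg_d1 _]|da0]; [by left..|].
    by right; exact: val_inj.
  by exists (Delta mem_y).
Qed.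

Lemma reassoc_delta_incl_lD (x x' : L) :
  reassoc (delta_incl_l (x + x')) =
  lex_add (reassoc (delta_incl_l x)) (reassoc (delta_incl_l x')).
Proof.
case: x x' => [[[[d1 d2] mem_d] a] mem_x] [[[[e1 e2] mem_e] b] mem_x'].
rewrite /lex_add /reassoc /delta_incl_l /= !delta_ltE /= (eq_sym e1).
by rewrite /delta_add_val /=; case: dioid_ltgtP.
Qed.

Lemma delta_incl_rD (y y' : R) :
  delta_incl_r (y + y') = lex_add (delta_incl_r y) (delta_incl_r y').
Proof. by rewrite /lex_add /delta_incl_r /= !(fun_if (@delta_val _ _)). Qed.

End IteratedDeltaProduct.

Theorem theorem5 (D1 D2 : ctiDioidType) (A : comNzSemiRingType) :
  let L := delta (delta D1 D2) A in
  let R := delta D1 (delta D2 A) in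
  let iL := fun x : L => reassoc (delta_incl_l x) in
  let iR := fun y : R => delta_incl_r y in
  [/\ range iL = range iR,
      forall (x x' : L) (y y' : R),
        iL x = iR y -> iL x' = iR y' -> iL (x + x') = iR (y + y'),
      forall (x x' : L) (y y' : R),
        iL x = iR y -> iL x' = iR y' -> iL (x * x') = iR (y * y'),
      iL 0 = iR 0
    & iL 1 = iR 1].
Proof.
move=> L R iL iR; split=> //.
- by rewrite /iL range_reassoc_delta_incl_l range_delta_incl_r.
- rewrite /iL /iR => x x' y y' eq_xy eq_xy'.
  by rewrite reassoc_delta_incl_lD eq_xy eq_xy' delta_incl_rD.
- move=> x x' y y'; rewrite /iL /iR /reassoc /delta_incl_r /=.
  by move=> -[-> <-] [-> <-].
Qed.
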